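(* Let $n\geq 2$ and let $\Omega\subset\mathbb{C}^n$ be a bounded convex domain with smooth boundary. Let $\phi=(\phi_1,\dots,\phi_n):\Omega\to\Omega$ be such that each coordinate function $\phi_j$ is holomorphic on $\Omega$ and is $C^1$-smooth on $\overline{\Omega}$. If $\phi$ is a surjective proper map, then the composition operator $C_\phi$, $C_\phi(f)=f\circ\phi$, is not compact on $A^2(\Omega)$.
   Context: $A^2(\Omega)$ is the Bergman space of holomorphic functions $f:\Omega\to\mathbb{C}$ with $\int_\Omega |f|^2\,dV<\infty$, where $V$ is Lebesgue volume measure, with norm $\|f\|_{2,\Omega}=\left(\int_\Omega|f|^2\,dV\right)^{1/2}$. A map $\phi:\Omega\to\Omega$ is proper if preimages of compact subsets of $\Omega$ are compact. A linear operator between Banach spaces is compact if the image of the open unit ball is relatively compact in norm. *)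

(* Defs.v *)
(* Written on top of Mathematical Components and MathComp-Analysis. *)
From HB Require Import structures.
From mathcomp Require Import all_boot all_order all_algebra.
From mathcomp Require Import all_classical all_reals all_analysis.
From mathcomp Require Import measurable_realfun complex.
From mathcomp Require Import ring lra.
Set Implicit Arguments.
Unset Strict Implicit.
Unset Printing Implicit Defensive.
Import Order.TTheory GRing.Theory Num.Theory.
Import numFieldNormedType.Exports.
Import Normc.
Local Open Scope classical_set_scope.
Local Open Scope ring_scope.
Local Open Scope complex_scope.

(* R[i] as a normed space over itself; C^n is 'rV[R[i]]_n with the sup norm,
   and differentiability of functions on it is complex differentiability. *)
HB.instance Definition _ (R : realType) := NormedModule.copy R[i] R[i]^o.

Section lebesgue_tuple.
Context {R : realType}.
Local Notation RT := (measurableTypeR R).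

Definition tcons m (p : RT * m.-tuple RT) : m.+1.-tuple RT :=
  [tuple of p.1 :: p.2].

Lemma measurable_tcons m : measurable_fun setT (@tcons m).
Proof. exact: measurable_cons. Qed.

Lemma measurable_tuple_box m (c : m.-tuple RT) (r : R) :
  measurable [set t : m.-tuple RT | forall i, ball (tnth c i) r (tnth t i)].
Proof.
rewrite [X in measurable X](_ : _ =
    \bigcap_(i in [set: 'I_m]) ((tnth (T:=RT))^~ i @^-1` ball (tnth c i) r)).
  apply: fin_bigcap_measurable => // i _; rewrite -[X in measurable X]setTI.
  by apply: measurable_tnth => //; exact: measurable_ball.
by apply/seteqP; split=> t /= h i; [move=> ?|]; exact: h.
Qed.

Section step.
Variables (m : nat) (mu : {sigma_finite_measure set (m.-tuple RT) -> \bar R}).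

Definition lebesgue_tcons : set (m.+1.-tuple RT) -> \bar R :=
  pushforward (@lebesgue_measure R \x mu)%E (@tcons m).

HB.instance Definition _ := Measure.copy lebesgue_tcons
  (measure_function_pushforward__canonical__measure_function_Measure
    (@lebesgue_measure R \x mu)%E (@measurable_tcons m)).

Lemma lebesgue_tconsE (A : set RT) (B : set (m.-tuple RT)) :
  measurable A -> measurable B ->
  lebesgue_tcons [set t | A (tnth t ord0) /\ B [tuple of behead t]] =
  (@lebesgue_measure R A * mu B)%E.
Proof.
move=> mA mB; rewrite -product_measure1E//; congr (_ \x _)%E.
apply/seteqP; split=> [[x t]|[x t]] /=.
  rewrite (_ : [tuple of _] = t)//; exact: val_inj.
rewrite (_ : [tuple of _] = t)//; exact: val_inj.
Qed.

Let lebesgue_tcons_sigma_finite : sigma_finite setT lebesgue_tcons.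
Proof.
have /sigma_finiteP[F [TF ndF Foo]] := sigma_finiteT (@lebesgue_measure R).
have /sigma_finiteP[G [TG ndG Goo]] := sigma_finiteT mu.
exists (fun k => [set t | F k (tnth t ord0) /\ G k [tuple of behead t]]).
  apply/seteqP; split=> // t _.
  have [i _ Fi] : (\bigcup_i F i) (tnth t ord0) by rewrite -TF.
  have [j _ Gj] : (\bigcup_i G i) [tuple of behead t] by rewrite -TG.
  exists (maxn i j) => //; split.
    by move: Fi; apply/subsetPset/ndF/leq_maxl.
  by move: Gj; apply/subsetPset/ndG/leq_maxr.
move=> k; have [mF Fk] := Foo k; have [mG Gk] := Goo k; split.
  apply: measurableI.
    by rewrite -[X in measurable X]setTI; exact: measurable_tnth.
  by rewrite -[X in measurable X]setTI; exact: measurable_behead.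
by rewrite lebesgue_tconsE// lte_mul_pinfty// ge0_fin_numE.
Qed.

HB.instance Definition _ := Measure_isSigmaFinite.Build _ _ _ lebesgue_tcons
  lebesgue_tcons_sigma_finite.
End step.

(* Lebesgue measure on R^m: the m-fold product of one-dimensional Lebesgue
   measure. *)
Fixpoint lebesgue_tuple (m : nat) :
    {sigma_finite_measure set (m.-tuple RT) -> \bar R} :=
  if m is m'.+1 then lebesgue_tcons (lebesgue_tuple m') else
  dirac ([tuple] : 0.-tuple RT).

Lemma lebesgue_tuple_box m (c : m.-tuple RT) (r : R) : 0 < r ->
  (0 < lebesgue_tuple m [set t | forall i, ball (tnth c i) r (tnth t i)])%E.
Proof.
move=> r0; elim: m c => [|m IH] c.
  by rewrite /= diracE mem_set// => -[].
set A := ball (tnth c ord0) r.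
set B := [set s : m.-tuple RT |
  forall i, ball (tnth [tuple of behead c] i) r (tnth s i)].
rewrite [X in (0 < lebesgue_tuple _ X)%E](_ : _ =
    [set t | A (tnth t ord0) /\ B [tuple of behead t]]); last first.
  apply/seteqP; split=> t /=.
    by move=> h; split=> [|i]; rewrite ?tnth_behead; exact: h.
  move=> [h0 h] i; have [->//|] := eqVneq i ord0.
  rewrite eq_sym => /unlift_some[j -> _].
  have jE : inord j.+1 = lift ord0 j.
    by apply/val_inj; rewrite /= inordK// ltnS; exact: ltn_ord.
  by have := h j; rewrite !tnth_behead jE.
have mA : measurable (A : set RT) by exact: measurable_ball.
have mB : measurable B by exact: measurable_tuple_box.
suff : (0 < @lebesgue_measure R A * lebesgue_tuple m B)%E.
  by rewrite -(lebesgue_tconsE (lebesgue_tuple m) mA mB).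
apply: mule_gt0; last exact: IH.
by rewrite lebesgue_measure_ball ?ltW// lte_fin mulrn_wgt0.
Qed.
End lebesgue_tuple.

Section volume.
Context {R : realType}.
Local Notation RT := (measurableTypeR R).
Local Notation Cn n := 'rV[R[i]]_n.

(* The identification R^(2n) = C^n, (x, y) |-> x + i y. *)
Definition cvec n (x : 'rV[R]_(n + n)) : Cn n :=
  \row_j (x ord0 (lshift n j) +i* x ord0 (rshift n j)).

Definition cvec_tuple n (t : (n + n).-tuple RT) : Cn n :=
  cvec (\row_i tnth t i).

Lemma normc_le_ReIm (z : R[i]) : normc z <= `|complex.Re z| + `|complex.Im z|.
Proof.
case: z => a b /=.
rewrite -[leRHS]ger0_norm ?addr_ge0// -sqrtr_sqr ler_wsqrtr//.
rewrite sqrrD !real_normK ?num_real// addrAC lerDl mulrn_wge0// mulr_ge0//.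
Qed.

Lemma cvec_tuple_box n (A : set (Cn n)) (t : (n + n).-tuple RT) :
  open A -> A (cvec_tuple t) -> exists2 r : R, 0 < r &
    forall s, (forall i, ball (tnth t i) r (tnth s i)) -> A (cvec_tuple s).
Proof.
move=> oA At; have /nbhs_ballP[e /= e0 eA] := open_nbhs_nbhs (conj oA At).
have eR : e = (complex.Re e)%:C by rewrite RRe_real// ger0_real ?ltW.
have r0 : 0 < complex.Re e by rewrite -ltcR -eR.
exists (complex.Re e / 2); first by rewrite divr_gt0.
move=> s ts; apply: eA; split=> // i j.
rewrite /ball/= [X in `|X| < _](_ : _ =
    (tnth t (lshift n j) - tnth s (lshift n j)) +i*
    (tnth t (rshift n j) - tnth s (rshift n j))); last by rewrite !mxE.
rewrite normc_def eR ltcR -/(normc (_ +i* _)).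
apply: le_lt_trans (normc_le_ReIm _) _ => /=.
by rewrite [ltRHS]splitr ltrD//; exact: ts.
Qed.

Lemma measurable_cvec_tuple n :
  measurable_fun [set: (n + n).-tuple RT]
    (@cvec_tuple n : _ -> g_sigma_algebraType (@open (Cn n))).
Proof.
suff : preimage_set_system setT (@cvec_tuple n) (@open (Cn n)) `<=` measurable.
  exact: (@measurability _ _ ((n + n).-tuple RT : measurableType _)
    (g_sigma_algebraType (@open (Cn n)) : measurableType _) setT
    (@cvec_tuple n) (@open (Cn n)) erefl).
move=> _ [A oA <-].
rewrite setTI.
pose box (p : (n + n).-tuple rat * nat) := [set t : (n + n).-tuple RT |
  forall i, ball (ratr (tnth p.1 i) : R) (p.2.+1%:R^-1 : R) (tnth t i)].
have mbox p : measurable (box p).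
  have := @measurable_tuple_box R _ [tuple of map ratr p.1] p.2.+1%:R^-1.
  congr measurable; apply/seteqP; split=> t h i; have := h i;
  by rewrite tnth_map.
pose F p := [set t | box p t /\ box p `<=` @cvec_tuple n @^-1` A].
rewrite [X in measurable X](_ : _ = \bigcup_p F p).
  apply: countable_bigcupT_measurable => //.
  move=> p; have [pA|pA] := pselect (box p `<=` @cvec_tuple n @^-1` A).
    by rewrite (_ : F p = box p)//; apply/seteqP; split=> t; [case|].
  by rewrite (_ : F p = set0)// -subset0 => t [].
apply/seteqP; split=> [t At|t [p _] [pt]]; last exact.
have [r r0 rA] := cvec_tuple_box oA At.
pose k := Num.trunc (2 / r).
have kr : (k.+1%:R^-1 : R) < r / 2.
  rewrite -[ltRHS]invrK ltf_pV2 ?posrE ?invr_gt0 ?divr_gt0// invfM invrK mulrC.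
  exact: truncnS_gt.
have k0 : 0 < (k.+1%:R^-1 : R) by rewrite invr_gt0.
have /choice[q qt] : forall i, exists q : rat,
    ball (tnth t i) (k.+1%:R^-1 : R) (ratr q : R).
  move=> i; have [|q] := @rat_in_itvoo R (tnth t i) (tnth t i + k.+1%:R^-1).
    by rewrite ltrDl.
  rewrite in_itv/= => /andP[tq qt]; exists q.
  move: k0 tq qt; set e := _^-1 => e0 tq qt.
  by rewrite /ball/= ltr_distl; apply/andP; split; lra.
exists ([tuple of mktuple q], k) => //; split=> [i|s st] /=.
  by rewrite tnth_mktuple; exact/ball_sym.
apply: rA => i; rewrite (splitr r).
apply: ball_triangle (le_ball (ltW kr) (qt i)) (le_ball (ltW kr) _).
by have := st i; rewrite /= tnth_mktuple.
Qed.

(* Lebesgue measure on the Borel sets of C^n. *)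
Definition volume n : set (g_sigma_algebraType (@open (Cn n))) -> \bar R :=
  pushforward (@lebesgue_tuple R (n + n))
    (@cvec_tuple n : _ -> g_sigma_algebraType (@open (Cn n))).

HB.instance Definition _ n := Measure.copy (@volume n)
  (measure_function_pushforward__canonical__measure_function_Measure
    (@lebesgue_tuple R (n + n)) (@measurable_cvec_tuple n)).

Lemma cvec_tuple_surj n (z : Cn n) : exists t, cvec_tuple t = z.
Proof.
exists [tuple match fintype.split i with
              | inl j => complex.Re (z ord0 j)
              | inr j => complex.Im (z ord0 j)
              end | i < n + n].
apply/rowP => j; rewrite !mxE !tnth_mktuple.
by rewrite -[lshift n j]/(unsplit (inl j)) -[rshift n j]/(unsplit (inr j))
  !unsplitK; case: (z ord0 j).
Qed.

Lemma volume_gt0 n (A : set (Cn n)) : open A -> A !=set0 -> (0 < volume A)%E.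
Proof.
move=> oA [z Az]; have [t tz] := cvec_tuple_surj z.
move: Az; rewrite -tz => At; have [r r0 rA] := cvec_tuple_box oA At.
apply: lt_le_trans (lebesgue_tuple_box t r0) _.
apply: le_measure; rewrite ?inE; [exact: measurable_tuple_box| |exact: rA].
rewrite -[X in measurable X]setTI; apply: measurable_cvec_tuple => //.
exact: sub_sigma_algebra.
Qed.

End volume.

Section bergman.
Context {R : realType} {n : nat}.
Local Notation Cn := 'rV[R[i]]_n.
Local Notation BCn := (g_sigma_algebraType (@open Cn)).

Definition holomorphic (Om : set Cn) (f : Cn -> R[i]) :=
  forall z, Om z -> differentiable f z.

(* An element of A^2(Om) is represented by its extension by 0 to all of C^n,
   so that equality of representatives is equality on Om. *)
Definition bergman_pred (Om : set Cn) of open Om : {pred Cn -> R[i]} := [pred f | `[<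
  [/\ holomorphic Om f,
      (\int[@volume R n]_(z in (Om : set BCn)) (normc (f z) ^+ 2)%:E < +oo)%E &
      forall z, ~ Om z -> f z = 0] >]].

Variables (Om : set Cn) (oOm : open Om).

Lemma measurable_open (A : set Cn) : open A -> measurable (A : set BCn).
Proof. exact: sub_sigma_algebra. Qed.

Let normc_ge0 (x : R[i]) : 0 <= normc x.
Proof. by case: x => a b; exact: sqrtr_ge0. Qed.

Let normcE (x : R[i]) : (normc x)%:C = `|x|.
Proof. by []. Qed.

Lemma open_normc_gt (f : Cn -> R[i]) (a : R) : holomorphic Om f ->
  open (Om `&` [set z | a < normc (f z)]).
Proof.
move=> hf; rewrite openE => z [Omz /= az].
have cf : f w @[w --> z] --> f z.
  exact: differentiable_continuous (hf _ Omz).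
have e0 : 0 < (normc (f z) - a)%:C by rewrite ltcR subr_gt0.
apply: filterI; first exact: open_nbhs_nbhs.
move/cvgrPdist_lt : cf => /(_ _ e0); apply: filterS => w /=.
rewrite -normcE ltcR => fzw.
have := le_normcD (f z - f w : Rcomplex R) (f w : Rcomplex R).
by rewrite subrK; lra.
Qed.

Lemma measurable_normc (f : Cn -> R[i]) : holomorphic Om f ->
  measurable_fun (Om : set BCn) ((fun z => normc (f z)) : BCn -> R).
Proof.
move=> hf; apply: (measurability _ (RGenOInfty.measurableE R)).
move=> _ [_ [a ->] <-]; rewrite preimage_itvoy.
by apply: measurable_open; exact: open_normc_gt.
Qed.

Lemma measurable_bergman (f : Cn -> R[i]) : f \in bergman_pred oOm ->
  measurable_fun (setT : set BCn) ((fun z => normc (f z)) : BCn -> R).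
Proof.
move=> /asboolP[hf _ f0].
rewrite (_ : (fun z => normc (f z)) = ((fun z => normc (f z)) : BCn -> R) \_ Om).
  apply/(measurable_restrictT _ _).1 => //.
    exact: measurable_open.
  exact: measurable_normc.
apply/funext => z /=; rewrite patchE; case: ifPn => //.
by rewrite notin_setE => /f0 -> ; rewrite normc0.
Qed.

Definition bergman_norm (f : Cn -> R[i]) : R :=
  Num.sqrt (\int[@volume R n]_(z in (Om : set BCn)) (normc (f z) ^+ 2)).

Lemma bergman_Lnorm2 (f : Cn -> R[i]) : f \in bergman_pred oOm ->
  'N[@volume R n]_2%:E[EFin \o ((fun z => normc (f z)) : BCn -> R)]%E =
  (bergman_norm f)%:E.
Proof.
move=> /asboolP[hf foo f0].
have mOm := measurable_open oOm.
rewrite unlock /=.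
have E z : `|normc (f z)| `^ 2 = normc (f z) ^+ 2.
  by rewrite powR_mulrn// real_normK ?num_real.
under eq_integral do rewrite E.
have -> : (\int[@volume R n]_z (normc (f z) ^+ 2)%:E =
    \int[@volume R n]_(z in (Om : set BCn)) (normc (f z) ^+ 2)%:E)%E.
  rewrite [RHS]integral_mkcond; apply: eq_integral => z _; rewrite patchE.
  by case: ifPn => //; rewrite notin_setE => /f0 ->; rewrite normc0 expr0n.
rewrite -[in LHS](@fineK _ (\int[_]_(_ in _) _)%E); last first.
  by rewrite ge0_fin_numE// integral_ge0// => z _; rewrite lee_fin sqr_ge0.
by rewrite poweR_EFin powR12_sqrt// fine_ge0// integral_ge0// => z _;
  rewrite lee_fin sqr_ge0.
Qed.

Lemma bergman_pred_submod : submod_closed (bergman_pred oOm).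
Proof.
split.
  apply/asboolP; split=> //.
  by rewrite integral0_eq// => z _; rewrite normc0 expr0n.
move=> a f g Bf Bg.
have mf := measurable_bergman Bf; have mg := measurable_bergman Bg.
move/asboolP : (Bf) => [hf foo f0]; move/asboolP : (Bg) => [hg goo g0].
apply/asboolP; split.
- move=> z Omz; apply: differentiableD; last exact: hg.
  by apply: differentiableZ; exact: hf.
- have mOm := measurable_open oOm.
  have mfO : measurable_fun (Om : set BCn)
      (fun z => (normc (f z) ^+ 2 : R)%:E : \bar R).
    by apply/measurable_EFinP/measurable_funX; exact: measurable_normc.
  have mgO : measurable_fun (Om : set BCn)
      (fun z => (normc (g z) ^+ 2 : R)%:E : \bar R).
    by apply/measurable_EFinP/measurable_funX; exact: measurable_normc.
  pose k : R := 2 * normc a ^+ 2.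
  have k0 : 0 <= k by rewrite mulr_ge0// sqr_ge0.
  apply: (@le_lt_trans _ _ (\int[@volume R n]_(z in (Om : set BCn))
     (k%:E * (normc (f z) ^+ 2)%:E + 2%:E * (normc (g z) ^+ 2)%:E))%E).
    apply: ge0_le_integral => //.
    + by move=> z _; rewrite lee_fin sqr_ge0.
    + apply/measurable_EFinP/measurable_funX; apply: measurable_normc.
      move=> z Omz; apply: differentiableD; last exact: hg.
      by apply: differentiableZ; exact: hf.
    + by apply: emeasurable_funD; exact: measurable_funeM.
    + move=> z _; rewrite -!EFinM -EFinD lee_fin.
      have := le_normcD (a * f z : Rcomplex R) (g z : Rcomplex R).
      rewrite normcM => h.
      apply: (@le_trans _ _ ((normc a * normc (f z) + normc (g z)) ^+ 2)).
        apply: lerXn2r h; rewrite nnegrE ?normc_ge0//.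
        by rewrite addr_ge0 ?mulr_ge0 ?normc_ge0.
      rewrite /k -subr_ge0.
      by apply: le_trans (sqr_ge0 (normc a * normc (f z) - normc (g z))) _; lra.
  rewrite ge0_integralD//=; last 4 first.
  + by move=> z _; rewrite mule_ge0// lee_fin// sqr_ge0.
  + exact: measurable_funeM.
  + by move=> z _; rewrite mule_ge0// lee_fin// sqr_ge0.
  + exact: measurable_funeM.
  rewrite !ge0_integralZl_EFin//; try (by move=> z _; rewrite lee_fin sqr_ge0).
  by rewrite lte_add_pinfty// lte_mul_pinfty.
- by move=> z Omz; rewrite -[LHS]/(a * f z + g z) f0// g0// mulr0 addr0.
Qed.

HB.instance Definition _ :=
  GRing.isSubmodClosed.Build _ _ (bergman_pred oOm) bergman_pred_submod.

Record bergman := Bergman {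
  bergman_fun :> Cn -> R[i] ;
  _ : bergman_fun \in bergman_pred oOm }.

HB.instance Definition _ := [isSub for bergman_fun].
HB.instance Definition _ := [Choice of bergman by <:].
HB.instance Definition _ := [SubChoice_isSubLmodule of bergman by <:].

Let bergman_normC (f : bergman) : R[i] := (bergman_norm f)%:C.

Let bergman_normD f g :
  bergman_normC (f + g) <= bergman_normC f + bergman_normC g.
Proof.
rewrite /bergman_normC -rmorphD/= lecR -lee_fin EFinD.
have Bf := valP f; have Bg := valP g; have Bfg := valP (f + g).
rewrite -(bergman_Lnorm2 Bf) -(bergman_Lnorm2 Bg) -(bergman_Lnorm2 Bfg).
have mf := measurable_bergman Bf; have mg := measurable_bergman Bg.
apply: le_trans (minkowski_EFin _ mf mg (ler1n _ 2)).
have pos (h : Cn -> R) : (0 <= \int[@volume R n]_z (`|h z| `^ 2)%:E)%E.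
  by apply: integral_ge0 => z _; rewrite lee_fin powR_ge0.
have mpow (h : BCn -> R) : measurable_fun setT h ->
    measurable_fun setT (fun z => (`|h z| `^ 2)%:E : \bar R).
  move=> mh; apply/measurable_EFinP.
  rewrite (_ : (fun _ => _) = (fun z => h z ^+ 2)); last first.
    by apply/funext => z; rewrite powR_mulrn// real_normK ?num_real.
  exact: measurable_funX.
rewrite unlock /=; apply: gt0_ler_poweR; rewrite ?invr_ge0//.
- by rewrite in_itv/= leey andbT; exact: pos.
- by rewrite in_itv/= leey andbT; exact: pos.
apply: ge0_le_integral => //.
- by apply: mpow; exact: measurable_bergman Bfg.
- by apply: mpow; exact: measurable_funD.
move=> z _; rewrite lee_fin ge0_ler_powR ?nnegrE//.
rewrite !ger0_norm ?addr_ge0//.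
exact: le_normcD (f z : Rcomplex R) (g z : Rcomplex R).
Qed.

Let sq_ge0 (f : Cn -> R[i]) :
  (0 <= \int[@volume R n]_(z in (Om : set BCn)) (normc (f z) ^+ 2)%:E)%E.
Proof. by apply: integral_ge0 => z _; rewrite lee_fin sqr_ge0. Qed.

Let sq_fin (f : bergman) :
  (\int[@volume R n]_(z in (Om : set BCn)) (normc (f z) ^+ 2)%:E)%E
    \is a fin_num.
Proof. by rewrite ge0_fin_numE//; have /asboolP[] := valP f. Qed.

Let bergman_normZ (l : R[i]) (f : bergman) :
  bergman_normC (l *: f) = `|l| * bergman_normC f.
Proof.
have /asboolP[hf _ _] := valP f.
rewrite -normcE -rmorphM/=; congr _%:C.
rewrite /bergman_norm /Rintegral.
under eq_integral => z _ do
  rewrite -[(l *: f : Cn -> R[i]) z]/(l * f z) normcM exprMn EFinM.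
rewrite ge0_integralZl_EFin ?sqr_ge0//.
- by rewrite fineM//= sqrtrM ?sqr_ge0// sqrtr_sqr ger0_norm.
- exact: measurable_open.
- by move=> z _; rewrite lee_fin sqr_ge0.
- by apply/measurable_EFinP/measurable_funX; exact: measurable_normc.
Qed.

Let bergman_norm_eq0 (f : bergman) : bergman_normC f = 0 -> f = 0.
Proof.
move=> /(congr1 (@complex.Re R))/eqP; rewrite /= sqrtr_eq0 => f0.
have /asboolP[hf _ f0'] := valP f.
apply/val_inj/funext => z; apply: contrapT => /eqP fz.
have Omz : Om z by apply: contrapT => /f0'; exact/eqP.
have nz : 0 < normc (f z).
  rewrite lt_neqAle normc_ge0 andbT eq_sym; apply: contra fz.
  by move=> /eqP/eq0_normc fz; exact/eqP.
pose a := normc (f z) / 2; pose U := Om `&` [set w | a < normc (f w)].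
have a0 : 0 < a by rewrite divr_gt0.
have oU : open U by exact: open_normc_gt.
have mU := measurable_open oU; have mOm := measurable_open oOm.
have U0 : (0 < @volume R n U)%E.
  apply: volume_gt0 => //; exists z; split=> //=.
  by rewrite /a ltr_pdivrMr// ltr_pMr// ltr1n.
suff : (0 < \int[@volume R n]_(z in (Om : set BCn)) (normc (f z) ^+ 2)%:E)%E.
  by rewrite -(fineK (sq_fin f)) lte_fin ltNge f0.
have mf2 : measurable_fun (Om : set BCn)
    (fun z => (normc (f z) ^+ 2 : R)%:E : \bar R).
  by apply/measurable_EFinP/measurable_funX; exact: measurable_normc.
apply: (@lt_le_trans _ _ (\int[@volume R n]_(z in (U : set BCn)) (a ^+ 2)%:E)%E).
  by rewrite integral_cst// mule_gt0// lte_fin exprn_gt0.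
apply: (@le_trans _ _
    (\int[@volume R n]_(z in (U : set BCn)) (normc (f z) ^+ 2)%:E)%E).
  apply: ge0_le_integral => //.
  - by move=> w _; rewrite lee_fin sqr_ge0.
  - by apply: measurable_funS mf2 => // w [].
  - by move=> w [_ /= /ltW aw]; rewrite lee_fin lerXn2r// nnegrE// ltW.
apply: ge0_subset_integral => //; last by move=> w [].
by move=> w _; rewrite lee_fin sqr_ge0.
Qed.

HB.instance Definition _ := Lmodule_isNormed.Build R[i] bergman
  bergman_normD bergman_normZ bergman_norm_eq0.

Lemma bergman_normE (f : bergman) : `|f| = (bergman_norm f)%:C.
Proof. by []. Qed.

End bergman.

Section regularity.
Context {R : realType} {m : nat}.
Implicit Types (D U : set 'rV[R]_m) (u rho : 'rV[R]_m -> R).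

Fixpoint Ck_on (k : nat) D u : Prop :=
  if k is k'.+1 then
    (forall x, D x -> differentiable u x) /\ forall v, Ck_on k' D ('D_v u)
  else forall x, D x -> {for x, continuous u}.

Definition smooth_on D u := forall k, Ck_on k D u.

(* Near each boundary point D is a strict sublevel set of a C^oo function
   whose differential does not vanish at that point. *)
Definition smooth_boundary D :=
  forall p, (closure D `\` D°) p -> exists U rho,
    [/\ open U, U p, smooth_on U rho,
        forall x, U x -> (D x <-> rho x < 0) &
        exists v, 'D_v rho p != 0].

Definition extends_to_closure D u :=
  exists2 g : 'rV[R]_m -> R,
    {within closure D, continuous g} & forall x, D x -> g x = u x.

(* u is C^1 on the open set D, and u and its first-order partial derivatives
   extend continuously to the closure of D. *)
Definition C1_on_closure D u :=
  [/\ forall x, D x -> differentiable u x,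
      extends_to_closure D u &
      forall v, extends_to_closure D ('D_v u)].

End regularity.

(* C^1-smoothness of complex-valued functions is with respect to the 2n real
   variables. *)
Definition C1_on_cclosure {R : realType} n (Om : set 'rV[R[i]]_n)
    (f : 'rV[R[i]]_n -> R[i]) :=
  C1_on_closure (@cvec R n @^-1` Om) (fun x => complex.Re (f (cvec x))) /\
  C1_on_closure (@cvec R n @^-1` Om) (fun x => complex.Im (f (cvec x))).

(* For K included in A, compactness in A and in the ambient space coincide. *)
Definition proper_on {T : topologicalType} (A : set T) (phi : T -> T) :=
  forall K, K `<=` A -> compact K -> compact (A `&` phi @^-1` K).

Definition compact_operator {K : numFieldType} {V W : normedModType K}
    (T : V -> W) := precompact (T @` [set x | `|x| < 1]).

(* Main.v *)
Require Import Defs.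
From mathcomp Require Import all_boot all_order all_algebra.
From mathcomp Require Import all_classical all_reals all_analysis.
From mathcomp Require Import complex.
From mathcomp Require Import measurable_realfun ring lra.
Set Implicit Arguments.
Unset Strict Implicit.
Unset Printing Implicit Defensive.
Import Order.TTheory GRing.Theory Num.Theory.
Import numFieldNormedType.Exports.
Local Open Scope classical_set_scope.
Local Open Scope ring_scope.

(* Since phi is C^1 up to the boundary of a bounded convex domain, it is
   Lipschitz, so it enlarges volumes by at most a constant factor K; since it is
   onto, vol A = vol (phi (phi^-1 A)) <= K vol (phi^-1 A) for A open in Om.
   Applied to the superlevel sets of |f|^2, this gives
   ||f||^2 <= K ||f o phi||^2, so C_phi is bounded below.  On the other hand the
   normalized powers f_k = z_j^k / ||z_j^k|| tend to 0 locally uniformly because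
   |z_j| does not attain its supremum on Om, so every cluster point of the
   sequence f_k o phi is 0, and its norm cannot be bounded below. *)

(** * Volume and Lipschitz maps *)

Section tuple_volume.
Context {R : realType}.
Local Notation RT := (measurableTypeR R).

Lemma measurable_tuple_prod m (A : 'I_m -> set RT) :
  (forall i, measurable (A i)) ->
  measurable [set t : m.-tuple RT | forall i, A i (tnth t i)].
Proof.
move=> mA; rewrite [X in measurable X](_ : _ =
    \bigcap_(i in [set: 'I_m]) ((tnth (T:=RT))^~ i @^-1` A i)).
  apply: fin_bigcap_measurable => // i _; rewrite -[X in measurable X]setTI.
  by apply: measurable_tnth => //; exact: mA.
by apply/seteqP; split=> t /= h i; [move=> ?|]; exact: h.
Qed.

Lemma lebesgue_tuple_prod m (A : 'I_m -> set RT) (c : R) :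
  (forall i, measurable (A i)) ->
  (forall i, @lebesgue_measure R (A i) = c%:E) ->
  lebesgue_tuple m [set t | forall i, A i (tnth t i)] = (c ^+ m)%:E.
Proof.
elim: m A => [|m IH] A mA cA.
  by rewrite /= diracE mem_set// => -[].
set B := [set s : m.-tuple RT | forall i, A (lift ord0 i) (tnth s i)].
have mB : measurable B.
  by apply: (@measurable_tuple_prod _ (fun i => A (lift ord0 i))) => i.
rewrite [X in lebesgue_tuple _ X](_ : _ =
    [set t | A ord0 (tnth t ord0) /\ B [tuple of behead t]]); last first.
  have beheadE (t : m.+1.-tuple RT) j :
      tnth [tuple of behead t] j = tnth t (lift ord0 j).
    rewrite tnth_behead; congr tnth; apply/val_inj.
    by rewrite /= inordK// ltnS; exact: ltn_ord.
  apply/seteqP; split=> t /=.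
    by move=> h; split=> [|i]; rewrite ?beheadE; exact: h.
  move=> [h0 h] i; have [->//|] := eqVneq i ord0.
  by rewrite eq_sym => /unlift_some[j -> _]; have := h j; rewrite beheadE.
rewrite [LHS](lebesgue_tconsE (lebesgue_tuple m) (mA ord0) mB).
by rewrite cA (IH (fun i => A (lift ord0 i)))// exprS EFinM.
Qed.

(** Half-open cubes of side 1/(k+1) that partition the space for each fixed k. Integer tuples form a
    countable type, so the cells can be enumerated. *)
Let cell m k (a : m.-tuple int) : set (m.-tuple RT) :=
  [set t | forall i, Num.floor (k.+1%:R * tnth t i : R) = tnth a i].

Let floor_set k (a : int) : set RT :=
  [set x : R | Num.floor (k.+1%:R * x) = a].

Let floor_setE k a :
  floor_set k a = `[a%:~R / k.+1%:R, (a + 1)%:~R / k.+1%:R[%classic.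
Proof.
apply/seteqP; split=> x /=.
  move/eqP; rewrite floor_eq in_itv/= ler_pdivrMr// ltr_pdivlMr//.
  by rewrite mulrC.
rewrite in_itv/= ler_pdivrMr// ltr_pdivlMr// mulrC => ?.
by apply/eqP; rewrite floor_eq.
Qed.

Let mfloor_set k a : measurable (floor_set k a).
Proof. by rewrite floor_setE; exact: measurable_itv. Qed.

Let mcell m k (a : m.-tuple int) : measurable (cell k a).
Proof.
by apply: (@measurable_tuple_prod _ (fun i => floor_set k (tnth a i))) => i.
Qed.

Let cell_vol m k (a : m.-tuple int) :
  lebesgue_tuple m (cell k a) = ((k.+1%:R^-1) ^+ m)%:E.
Proof.
apply: (@lebesgue_tuple_prod _ (fun i => floor_set k (tnth a i))) => // i.
rewrite floor_setE lebesgue_measure_itv/= lte_fin.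
rewrite ltr_pM2r ?invr_gt0// ltr_int ltrDl ltr01 -EFinB -mulrBl.
by rewrite -intrB [_ + 1]addrC addrK mul1r.
Qed.

Let cell_dist m k (a : m.-tuple int) t s : cell k a t -> cell k a s ->
  forall i, `|tnth t i - tnth s i| < k.+1%:R^-1 :> R.
Proof.
move=> ta sa i; have := floor_itv (k.+1%:R * tnth t i : R).
have := floor_itv (k.+1%:R * tnth s i : R); rewrite ta sa intrD.
set z := (tnth a i)%:~R => /andP[s1 s2] /andP[t1 t2].
rewrite -(ltr_pM2l (ltr0Sn R k)) divff// -{1}(ger0_norm (ler0n R k.+1)).
rewrite -normrM mulrBr ltr_norml; apply/andP; split; lra.
Qed.

(* Image of a cell of side [1/(k+1)] lies in a cube of side [2L/(k+1)]; summing
   over the cells inside [U] covers all of [A] in the limit [k -> oo]. *)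
Lemma lipschitz_image_volume m (Phi : m.-tuple RT -> m.-tuple RT)
    (U A : set (m.-tuple RT)) (L : R) :
  0 < L -> measurable U -> measurable A ->
  (forall t, U t -> exists2 r : R, 0 < r &
     forall s, (forall i, ball (tnth t i) r (tnth s i)) -> U s) ->
  (forall t s (r : R), U t -> U s -> 0 < r ->
     (forall i, `|tnth t i - tnth s i| < r) ->
     forall i, `|tnth (Phi t) i - tnth (Phi s) i| < L * r) ->
  A `<=` Phi @` U ->
  (lebesgue_tuple m A <= ((L *+ 2) ^+ m)%:E * lebesgue_tuple m U)%E.
Proof.
move=> L0 mU mA oU lip AU.
set K := (L *+ 2) ^+ m.
have K0 : 0 <= K by rewrite exprn_ge0// mulrn_wge0// ltW.
have rk0 k : 0 < (k.+1%:R^-1 : R) by rewrite invr_gt0.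
(* [t0] is only a default for [xget]: [c k a] is used below as a point of a cell already known to be
   inhabited. *)
pose t0 : m.-tuple RT := [tuple of nseq m 0].
pose c k (a : m.-tuple int) := xget t0 (cell k a).
pose box k a := [set s : m.-tuple RT |
  forall i, ball (tnth (Phi (c k a)) i) (L / k.+1%:R) (tnth s i)].
(* Natural numbers enumerate the cells contained in U. Several codes may decode to the same tuple;
   the test [pickle a == n] keeps one of them, so that no cell is counted twice in [tG]. *)
pose good k n : option (m.-tuple int) :=
  if unpickle n is Some a then
    if `[< cell k a `<=` U >] then
      if pickle a == n then Some a else None else None else None.
pose F k n := if good k n is Some a then box k a else set0.
pose G k n := if good k n is Some a then cell k a else set0.
have mF k n : measurable (F k n).
  by rewrite /F; case: (good k n) => // a; exact: measurable_tuple_box.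
have mG k n : measurable (G k n).
  by rewrite /G; case: (good k n) => // a; exact: mcell.
(* The cube has side 2L/(k+1) and the cell 1/(k+1), so the volume ratio is K at every scale k. *)
have FG k n : lebesgue_tuple m (F k n) = (K%:E * lebesgue_tuple m (G k n))%E.
  rewrite /F /G; case: (good k n) => [a|]; last by rewrite !measure0 mule0.
  rewrite cell_vol -EFinM -exprMn.
  apply: (@lebesgue_tuple_prod _
    (fun i => ball (tnth (Phi (c k a)) i) (L / k.+1%:R))) => i.
    exact: measurable_ball.
  by rewrite lebesgue_measure_ball ?divr_ge0 ?ltW// mulrnAl.
have GU k n : G k n `<=` U.
  rewrite /G /good; case: (unpickle n) => [a|]; last exact: sub0set.
  case: asboolP => aU; last exact: sub0set.
  by case: ifP => _ //; exact: sub0set.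
have tG k : trivIset setT (G k).
  apply/trivIsetP => i j _ _ ij; rewrite -subset0 /G /good => t.
  case: (unpickle i) => [a|]; last by case.
  case: asboolP => _; last by case.
  case: eqP => [ai|_]; last by case.
  case: (unpickle j) => [b|]; last by case.
  case: asboolP => _; last by case.
  case: eqP => [bj|_]; last by case.
  move=> [ta tb]; move/eqP: ij; apply; rewrite -ai -bj; congr pickle.
  by apply: eq_from_tnth => l; rewrite -ta -tb.
pose B k := \bigcup_n F k n.
have mB k : measurable (B k) by exact: bigcupT_measurable.
have BU k : (lebesgue_tuple m (B k) <= K%:E * lebesgue_tuple m U)%E.
  apply: (@le_trans _ _ (\sum_(n <oo) lebesgue_tuple m (F k n))%E).
    exact: measure_sigma_subadditive.
  under eq_eseriesr do rewrite FG.
  rewrite nneseriesZl//.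
  rewrite -(@measure_semi_bigcup _ _ _ (lebesgue_tuple m) (G k))//;
    last exact: bigcupT_measurable.
  apply: lee_wpmul2l; first by rewrite lee_fin.
  by apply: le_measure; rewrite ?inE;
    [exact: bigcupT_measurable|by []|exact: bigcup_sub].
(* A point of A is covered by [B k] only for k large, and the [B k] need not be monotone. Their tail
   intersections are increasing, so continuity from below carries the bound [BU] to the limit. *)
pose C N := \bigcap_(k >= N) B k.
have mC N : measurable (C N) by exact: bigcap_measurableType.
have ndC : nondecreasing_seq C.
  move=> i j ij; apply/subsetPset => t Ct k /= jk; apply: Ct => /=.
  exact: leq_trans jk.
have AC : A `<=` \bigcup_N C N.
  move=> s /AU[t Ut ts]; have [r r0 rU] := oU _ Ut.
  (* For these k the side 1/(k+1) is less than r, so the whole cell around t stays in U. *)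
  exists (Num.trunc r^-1) => // k /= Nk.
  have kr : (k.+1%:R^-1 : R) < r.
    rewrite -[ltRHS]invrK ltf_pV2 ?posrE ?invr_gt0//.
    by apply: lt_le_trans (truncnS_gt _) _; rewrite ler_nat ltnS.
  pose a := [tuple Num.floor (k.+1%:R * tnth t i : R) | i < m].
  have at_ : cell k a t by move=> i; rewrite tnth_mktuple.
  have aU : cell k a `<=` U.
    move=> u au; apply: rU => i; apply: lt_trans kr.
    exact: cell_dist at_ au i.
  exists (pickle a) => //; rewrite /F /good pickleK.
  case: asboolP => // _; rewrite eqxx => i.
  have ac : cell k a (c k a) by apply: (xgetPex t0); exists t.
  rewrite -ts; apply: lip => //; first exact: aU.
  exact: cell_dist.
have mCU : measurable (\bigcup_N C N) by exact: bigcupT_measurable.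
apply: (@le_trans _ _ (lebesgue_tuple m (\bigcup_N C N))).
  by apply: le_measure; rewrite ?inE.
have := nondecreasing_cvg_mu mC mCU ndC.
move/(_ _ (lebesgue_tuple m)) => cvgC.
rewrite -(cvg_lim _ cvgC)//; apply: lime_le.
  by apply/cvg_ex; eexists; exact: cvgC.
apply: nearW => N /=; apply: le_trans (BU N).
by apply: le_measure; rewrite ?inE//; apply: bigcap_inf => /=.
Qed.

End tuple_volume.

(** * Lipschitz bounds from C^1 regularity up to the boundary *)

Section lipschitz.
Context {R : realType}.

(** The closure of a bounded set is compact, and the continuous extension is bounded on it. *)
Lemma extends_to_closure_bounded m (D : set 'rV[R]_m) (u : 'rV[R]_m -> R) :
  bounded_set D -> extends_to_closure D u ->
  exists2 M : R, 0 <= M & forall x, D x -> `|u x| <= M.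
Proof.
move=> [B0 [_ DB0]] [g cg gu]; pose B := B0 + 1.
have DB x : D x -> `|x| <= B by apply: (DB0 B); rewrite ltrDl.
have cD : compact (closure D).
  apply: bounded_closed_compact; last exact: closed_closure.
  exists B; split; first exact: num_real.
  move=> B' BB' x Dx /=; apply: le_trans (ltW BB').
  have clB : closed [set y : 'rV[R]_m | `|y| <= B].
    exact: (closed_comp (fun y _ => @norm_continuous _ _ y) (@closed_le _ B)).
  by have := closure_subset DB; rewrite -((closure_id _).1 clB); exact.
have /compact_bounded[M0 [_ gM0]] := continuous_compact cg cD.
have gM := gM0 (M0 + 1) (ltr_pwDr ltr01 (lexx _)).
(* The maximum with 0 keeps the bound nonnegative even when D is empty. *)
exists (Num.max (M0 + 1) 0); first by rewrite le_max lexx orbT.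
move=> x Dx; rewrite -gu// le_max; apply/orP; left.
by apply: gM; exists x => //; exact: subset_closure.
Qed.

Lemma rV_coord_norm m (v : 'rV[R]_m) i : `|v ord0 i| <= `|v|.
Proof.
rewrite [leRHS]mx_normrE.
exact: (le_bigmax _ (fun ij => `|v ij.1 ij.2|) (ord0, i)).
Qed.

(** The partial derivatives are bounded, and the segment condition allows the mean value theorem
    along the segment from x to y. *)
Lemma C1_on_closure_lipschitz m (D : set 'rV[R]_m) (u : 'rV[R]_m -> R) :
  bounded_set D ->
  (forall x y (t : R), D x -> D y -> 0 <= t -> t <= 1 ->
    D (x + t *: (y - x))) ->
  C1_on_closure D u ->
  exists2 L : R, 0 < L & forall x y, D x -> D y ->
    `|u y - u x| <= L * `|y - x|.
Proof.
move=> bD cD [du _ Du].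
have /choice[M] : forall i : 'I_m, exists M : R,
    0 <= M /\ forall x, D x -> `|'D_(delta_mx 0 i) u x| <= M.
  move=> i; have Di := Du (delta_mx 0 i).
  by have [M M0 MD] := extends_to_closure_bounded bD Di; exists M.
(* In the sup norm, the sum of the bounds on the partials controls every directional derivative;
   adding 1 makes it positive. *)
move=> HM; pose L := \sum_i M i + 1.
have S0 : 0 <= \sum_i M i by apply: sumr_ge0 => i _; have [] := HM i.
exists L; first by rewrite ltr_wpDl.
move=> x y Dx Dy.
have DL z v : D z -> `|'D_v u z| <= L * `|v|.
  move=> Dz; rewrite deriveE; last exact: du.
  rewrite [in leLHS](row_sum_delta v) linear_sum.
  apply: le_trans (ler_norm_sum _ _ _) _.
  apply: (@le_trans _ _ (\sum_i M i * `|v|)).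
    apply: ler_sum => i _; rewrite linearZ normrM mulrC.
    apply: ler_pM => //; last exact: rV_coord_norm.
    rewrite -deriveE; last exact: du.
    by have [_] := HM i; exact.
  by rewrite -mulr_suml ler_wpM2r// lerDl.
pose h (t : R) := u (x + t *: (y - x)).
pose dh t := 'D_(y - x) u (x + t *: (y - x)).
have hdh (t : R) : t \in `[0, 1]%R -> is_derive t 1 h (dh t).
  rewrite in_itv => /= /andP[t0 t1].
  have Dt := cD _ _ _ Dx Dy t0 t1.
  have du' := @diff_derivable _ _ _ u _ (y - x) (du _ Dt).
  (* The difference quotient of h at t is that of u in the direction y - x. *)
  have E : (fun s : R => s^-1 *: (h (s *: 1 + t) - h t)) =
      (fun s : R => s^-1 *: (u (s *: (y - x) + (x + t *: (y - x)))
        - u (x + t *: (y - x)))).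
    apply/funext => s; rewrite /h; congr (_ *: (u _ - _)).
    by rewrite addrCA -scalerDl [s *: 1]mulr1.
  split; first by rewrite /derivable E; exact: du'.
  exact: (congr1 (fun g : R -> R => lim (g @ 0^')) E).
have mvt := @MVT_segment _ h dh 0 1 ler01.
have h01 (t : R) : t \in `]0, 1[%R -> is_derive t 1 h (dh t).
  by move=> t01; apply: hdh; exact: subset_itv_oo_cc t01.
have hc : {within `[0, 1], continuous h}.
  by apply: derivable_within_continuous => t /hdh[].
have [c] := mvt h01 hc.
rewrite in_itv => /= /andP[t0 t1].
rewrite {1 2}/h subr0 mulr1 scale1r scale0r addr0 [x + _]addrC subrK => ->.
by apply: DL; exact: cD.
Qed.
End lipschitz.


(** * Comparison of integrals through superlevel sets *)

Section superlevel.
Context {R : realType}.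

(* Riemann sums of the layer-cake formula [x = \int_0^oo 1_(t < x) dt]. *)
Let layer (e x : R) (k : nat) : \bar R := (e * (k%:R * e < x)%R%:R)%:E.

Let layer_ge0 e x k : 0 <= e -> (0 <= layer e x k)%E.
Proof. by move=> e0; rewrite lee_fin mulr_ge0. Qed.

Let layer_le e x : 0 < e -> 0 <= x ->
  (x%:E <= \sum_(k <oo) layer e x k)%E.
Proof.
move=> e0 x0; pose N := (Num.trunc (x / e)).+1.
have Nx : x < N%:R * e by rewrite -ltr_pdivrMr// truncnS_gt.
apply: le_trans (@nneseries_lim_ge _ _ _ _ N _); last first.
  by move=> k _ _; rewrite layer_ge0// ltW.
rewrite /layer sumEFin lee_fin.
(* By induction, the M-th partial sum is at least the minimum of x and M e. At M = N both
   alternatives give x, since x < N e. *)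
suff : forall M, x <= \sum_(0 <= k < M) e * (k%:R * e < x)%R%:R
    \/ M%:R * e <= \sum_(0 <= k < M) e * (k%:R * e < x)%R%:R.
  by move=> /(_ N)[//|]; apply: le_trans; exact: ltW.
elim=> [|M IH]; first by right; rewrite mul0r big_nil.
rewrite big_nat_recr//=; set S := \sum_(_ <= _ < _) _ in IH *.
have [Mx|Mx] := ltP (M%:R * e) x; rewrite /= ?mulr1 ?mulr0 ?addr0.
  case: IH => IH; [left|right].
    by apply: le_trans IH _; rewrite lerDl ltW.
  by rewrite -natr1 mulrDl mul1r lerD2r.
by left; case: IH => // ; exact: le_trans.
Qed.

Let layer_ge e x : 0 < e -> 0 <= x ->
  (\sum_(k <oo) layer e x k <= (x + e)%:E)%E.
Proof.
move=> e0 x0; apply: lime_le.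
  by apply: is_cvg_nneseries => k _ _; rewrite layer_ge0// ltW.
apply: nearW => N; rewrite /layer sumEFin lee_fin.
(* The bound by N e strengthens the induction: when layer M is active, M e < x, so the earlier
   layers sum to less than x and one more e is affordable. *)
suff : \sum_(0 <= k < N) e * (k%:R * e < x)%R%:R <= N%:R * e /\
  \sum_(0 <= k < N) e * (k%:R * e < x)%R%:R <= x + e by case.
elim: N => [|M [IH1 IH2]].
  by rewrite big_nil mul0r; split=> //; rewrite addr_ge0// ltW.
rewrite big_nat_recr//=; set S := \sum_(_ <= _ < _) _ in IH1 IH2 *.
have [Mx|Mx] := ltP (M%:R * e) x; rewrite /= ?mulr1 ?mulr0 ?addr0
  -natr1 mulrDl mul1r.
  by split; rewrite lerD2r//; apply: le_trans IH1 _; exact: ltW.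
by split=> //; apply: le_trans IH1 _; rewrite lerDl ltW.
Qed.

Context d (T : measurableType d) (mu : {measure set T -> \bar R}).

Let superlevel (D : set T) (g : T -> R) e (k : nat) :=
  D `&` [set x | k%:R * e < g x]%R.

Let msuperlevel (D : set T) (g : T -> R) e k :
  measurable D -> measurable_fun D g -> measurable (superlevel D g e k).
Proof.
move=> mD mg; rewrite /superlevel.
rewrite -[X in D `&` X]/(g @^-1` [set y | k%:R * e < y]).
by rewrite -set_itvoy; apply: mg => //; exact: measurable_itv.
Qed.

Let layerE (D : set T) (g : T -> R) e k : {in D, (fun x => layer e (g x) k) =1
  (fun x => e%:E * (\1_(superlevel D g e k) x)%:E)%E}.
Proof.
move=> x Dx; rewrite /layer EFinM indicE in_setI Dx/=.
by congr (_ * (_%:R)%:E)%E; rewrite mem_setE.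
Qed.

Let mlayer (D : set T) (g : T -> R) e k : measurable D -> measurable_fun D g ->
  measurable_fun D (fun x => layer e (g x) k).
Proof.
move=> mD mg; apply: (eq_measurable_fun _ (fun x Dx => esym (layerE _ _ _ Dx))).
apply: measurable_funeM; apply/measurable_EFinP/measurable_indic.
exact: msuperlevel.
Qed.

Let integral_layer (D : set T) (g : T -> R) e k :
  0 <= e -> measurable D -> measurable_fun D g ->
  (\int[mu]_(x in D) layer e (g x) k = e%:E * mu (superlevel D g e k))%E.
Proof.
move=> e0 mD mg; have mA := msuperlevel e k mD mg.
rewrite (eq_integral (fun x => e%:E * (\1_(superlevel D g e k) x)%:E)%E);
  last by move=> x Dx; exact: layerE.
rewrite ge0_integralZl_EFin//; last exact/measurable_EFinP/measurable_indic.
by rewrite integral_indic// /superlevel setIAC setIid.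
Qed.

(** Cut both functions into layers of height e and compare layer by layer. The overshoot for h is at
    most e on each point, hence e mu(D) in total, which vanishes with e because D has finite
    measure. *)
Lemma integral_le_of_superlevel (D : set T) (g h : T -> R) (K : R) :
  0 <= K -> measurable D -> (mu D < +oo)%E ->
  measurable_fun D g -> measurable_fun D h ->
  (forall x, D x -> 0 <= g x) -> (forall x, D x -> 0 <= h x) ->
  (forall t, 0 <= t -> (mu (D `&` [set x | t < g x]%R) <=
     K%:E * mu (D `&` [set x | t < h x]%R))%E) ->
  (\int[mu]_(x in D) (g x)%:E <= K%:E * \int[mu]_(x in D) (h x)%:E)%E.
Proof.
move=> K0 mD Doo mg mh g0 h0 gh.
have Dfin : mu D \is a fin_num by rewrite ge0_fin_numE.
have step e : 0 < e -> (\int[mu]_(x in D) (g x)%:E <=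
    K%:E * \int[mu]_(x in D) (h x)%:E + (K * e * fine (mu D))%:E)%E.
  move=> e0; have e0' := ltW e0.
  apply: (@le_trans _ _ (\int[mu]_(x in D) (\sum_(k <oo) layer e (g x) k))%E).
    apply: ge0_le_integral => //.
    - exact/measurable_EFinP.
    - apply: ge0_emeasurable_sum => [k x Dx _|k _]; first exact: layer_ge0.
      exact: mlayer.
    - by move=> x Dx; apply: layer_le => //; exact: g0.
  rewrite integral_nneseries//; last 2 first.
  - by move=> k; exact: mlayer.
  - by move=> k x Dx; exact: layer_ge0.
  apply: (@le_trans _ _
      (\sum_(k <oo) (K%:E * \int[mu]_(x in D) layer e (h x) k))%E).
    apply: lee_nneseries => k _.
      by move=> _; apply: integral_ge0 => x _; exact: layer_ge0.
    rewrite !integral_layer// muleCA lee_wpmul2l//.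
    by apply: gh; rewrite mulr_ge0.
  rewrite nneseriesZl; last first.
    by move=> k _; apply: integral_ge0 => x _; exact: layer_ge0.
  rewrite -integral_nneseries//; last 2 first.
  - by move=> k; exact: mlayer.
  - by move=> k x Dx; exact: layer_ge0.
  rewrite -mulrA EFinM -ge0_muleDr; last 2 first.
  - by apply: integral_ge0 => x Dx; rewrite lee_fin h0.
  - by rewrite lee_fin mulr_ge0// fine_ge0.
  apply: lee_wpmul2l; first by rewrite lee_fin.
  apply: (@le_trans _ _ (\int[mu]_(x in D) ((h x)%:E + e%:E))%E).
    apply: ge0_le_integral => //.
    - by move=> x Dx; apply: nneseries_ge0 => k _ _; exact: layer_ge0.
    - apply: ge0_emeasurable_sum => [k x Dx _|k _]; first exact: layer_ge0.
      exact: mlayer.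
    - by apply: emeasurable_funD => //; exact/measurable_EFinP.
    - by move=> x Dx; rewrite -EFinD; apply: layer_ge => //; exact: h0.
  rewrite ge0_integralD//; last exact/measurable_EFinP.
  by rewrite integral_cst// EFinM fineK.
apply/lee_addgt0Pr => e e0.
(* Layers of height e/c make the error at most e; the added 1 keeps c positive. *)
pose c := K * fine (mu D) + 1.
have c0 : 0 < c by rewrite ltr_wpDl// mulr_ge0// fine_ge0.
apply: le_trans (step (e / c) (divr_gt0 e0 c0)) _.
apply: leeD2l; rewrite lee_fin mulrAC mulrA ler_pdivrMr//.
by rewrite mulrC ler_pM2l// /c lerDl.
Qed.

End superlevel.

(** * Real coordinates on C^n *)

Section cvec.
Context {R : realType} {n : nat}.
Local Notation RT := (measurableTypeR R).
Local Notation Cn := 'rV[R[i]]_n.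
Local Notation BCn := (g_sigma_algebraType (@open Cn)).
Import Normc.

(** Two-sided inverse of [cvec_tuple] ([re_imK], [cvec_tupleK]), through which phi is read as a map
    of real tuples. *)
Definition re_im (z : Cn) : (n + n).-tuple RT :=
  [tuple match fintype.split i with
         | inl j => complex.Re (z ord0 j)
         | inr j => complex.Im (z ord0 j)
         end | i < n + n].

Lemma re_imK : cancel re_im (@cvec_tuple R n).
Proof.
move=> z; apply/rowP => j; rewrite !mxE !tnth_mktuple.
by rewrite -[lshift n j]/(unsplit (inl j)) -[rshift n j]/(unsplit (inr j))
  !unsplitK; case: (z ord0 j).
Qed.

Lemma normc_Re (z : R[i]) : `|complex.Re z| <= normc z.
Proof.
by case: z => a b /=; rewrite -sqrtr_sqr ler_wsqrtr// lerDl sqr_ge0.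
Qed.

Lemma normc_Im (z : R[i]) : `|complex.Im z| <= normc z.
Proof.
by case: z => a b /=; rewrite -sqrtr_sqr ler_wsqrtr// lerDr sqr_ge0.
Qed.

Lemma bounded_set_normc (Om : set Cn) : bounded_set Om ->
  exists2 b : R, 0 < b & forall z, Om z -> forall j, normc (z ord0 j) < b.
Proof.
(* The bound M lies in R[i] and is known to be real. The first added 1 exceeds M, as [bounded_set]
   asks; the second makes the resulting inequality strict. *)
move=> [M [Mr OmM]]; pose c := `|M| + 1.
have Mc : M < c.
  by rewrite /c (le_lt_trans (real_ler_norm Mr))// ltrDl ltr01.
have c0 : 0 < c by rewrite ltr_wpDl.
pose e := c + 1.
have e0 : 0 < e by rewrite addr_gt0.
have eR : e = (complex.Re e)%:C%C by rewrite RRe_real// gtr0_real.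
exists (complex.Re e); first by rewrite -ltcR -eR.
move=> z Omz j; rewrite -ltcR -eR.
have ze : `|0 - z| < e.
  by rewrite sub0r normrN (le_lt_trans (OmM _ Mc _ Omz))// ltrDl.
have : ball (0 : Cn) e z by rewrite mx_norm_ball.
by move=> [_ /(_ ord0 j)]; rewrite /ball/= mxE sub0r normrN.
Qed.

Lemma cvec_norm_lt (x : 'rV[R]_(n + n)) (r : R) : 0 < r ->
  (forall i, `|x ord0 i| < r) -> `|x| < r.
Proof.
move=> r0 xr; rewrite [ltLHS]mx_normrE; apply/bigmax_ltP; split=> // -[i j] _.
by rewrite (ord1 i); exact: xr.
Qed.

Lemma bounded_cvec_preimage (Om : set Cn) :
  bounded_set Om -> bounded_set (@cvec R n @^-1` Om).
Proof.
move=> /bounded_set_normc[b b0 Omb]; exists b; split; first exact: num_real.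
move=> M bM x Omx; apply/ltW/(lt_trans _ bM)/cvec_norm_lt => // i.
rewrite -(splitK i); case: (fintype.split i) => j /=.
  apply: le_lt_trans (Omb _ Omx j); rewrite mxE; exact: normc_Re (_ +i* _)%C.
apply: le_lt_trans (Omb _ Omx j); rewrite mxE; exact: normc_Im (_ +i* _)%C.
Qed.

Lemma convex_cvec_preimage (Om : set Cn) x y (t : R) : convex_set Om ->
  (@cvec R n @^-1` Om) x -> (@cvec R n @^-1` Om) y -> 0 <= t -> t <= 1 ->
  (@cvec R n @^-1` Om) (x + t *: (y - x)).
Proof.
move=> cOm Omx Omy t0 t1.
(* The weights of [convex_set] lie in R[i], so the real t is embedded there. *)
have t0' : 0 <= (t%:C)%C by rewrite lecR.
have t1' : (t%:C)%C <= 1 by rewrite lecR.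
have E : (t%:C)%C *: cvec y + (1 - (t%:C)%C) *: cvec x =
    cvec (x + t *: (y - x)).
  apply/rowP => j; rewrite !mxE; apply/eqP.
  by rewrite eq_complex/=; apply/andP; split; apply/eqP; ring.
have := cOm _ _ (Itv01 t0' t1') (mem_set Omy) (mem_set Omx).
by rewrite inE /preimage/= -E.
Qed.

(** Strict bounds at every scale r match the hypothesis of [lipschitz_image_volume], which works
    with open cubes. *)
Definition re_im_lipschitz (Om : set Cn) (phi : Cn -> Cn) (L : R) :=
  forall t s (r : R), Om (cvec_tuple t) -> Om (cvec_tuple s) -> 0 < r ->
    (forall i, `|tnth t i - tnth s i| < r) ->
    forall i, `|tnth (re_im (phi (cvec_tuple t))) i -
                tnth (re_im (phi (cvec_tuple s))) i| < L * r.

Lemma C1_on_cclosure_lipschitz (Om : set Cn) (phi : Cn -> Cn) :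
  bounded_set Om -> convex_set Om ->
  (forall j, C1_on_cclosure Om (fun z => phi z ord0 j)) ->
  exists2 L, 0 < L & re_im_lipschitz Om phi L.
Proof.
move=> bOm cOm C1.
pose u (i : 'I_(n + n)) (x : 'rV[R]_(n + n)) : R :=
  tnth (re_im (phi (cvec x))) i.
have /choice[L HL] : forall i, exists L : R, 0 < L /\
    forall x y, Om (cvec x) -> Om (cvec y) -> `|u i y - u i x| <= L * `|y - x|.
  move=> i; have Ci : C1_on_closure (@cvec R n @^-1` Om) (u i).
    rewrite /u; under eq_fun do rewrite tnth_mktuple.
    by case: (fintype.split i) => j; have [] := C1 j.
  have [|L L0 HL] := C1_on_closure_lipschitz (bounded_cvec_preimage bOm) _ Ci.
    by move=> x y t; exact: convex_cvec_preimage.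
  by exists L; split.
pose M := \sum_i L i.
have LM i : L i <= M.
  rewrite /M (bigD1 i)//= lerDl sumr_ge0// => k _.
  by have [/ltW] := HL k.
(* The sum M dominates each coordinate's constant; the extra 1 makes the final inequality strict. *)
exists (M + 1).
  by rewrite ltr_wpDl// sumr_ge0// => k _; have [/ltW] := HL k.
move=> t s r Omt Oms r0 ts i.
have [Li0 Li] := HL i.
apply: le_lt_trans (Li _ _ Oms Omt) _.
apply: (@le_lt_trans _ _ (L i * r)); last first.
  by rewrite ltr_pM2r// (le_lt_trans (LM i))// ltrDl.
rewrite ler_pM2l//; apply/ltW/cvec_norm_lt => // k.
by rewrite !mxE; exact: ts.
Qed.

End cvec.

(** * The composition operator is bounded below *)

Section pullback.
Context {R : realType} {n : nat}.
Local Notation RT := (measurableTypeR R).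
Local Notation Cn := 'rV[R[i]]_n.
Local Notation BCn := (g_sigma_algebraType (@open Cn)).
Import Normc.

Lemma cvec_tupleK : cancel (@cvec_tuple R n) re_im.
Proof.
move=> t; apply: eq_from_tnth => i; rewrite tnth_mktuple.
by rewrite -{2}(splitK i); case: (fintype.split i) => j; rewrite !mxE.
Qed.

Lemma volume_bounded_lty (Om : set Cn) : bounded_set Om -> open Om ->
  (@volume R n Om < +oo)%E.
Proof.
move=> /bounded_set_normc[b b0 Omb] oOm.
rewrite -[X in (X < _)%E]/(lebesgue_tuple (n + n) (@cvec_tuple R n @^-1` Om)).
apply: (@le_lt_trans _ _ (lebesgue_tuple (n + n)
    [set t : (n + n).-tuple RT | forall i, ball (0 : RT) b (tnth t i)])).
  apply: le_measure; rewrite ?inE.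
  - rewrite -[X in measurable X]setTI; apply: measurable_cvec_tuple => //.
    exact: measurable_open.
  - by apply: (@measurable_tuple_prod _ _ (fun=> ball (0 : RT) b)) => i;
      exact: measurable_ball.
  move=> t /Omb bt i; rewrite /ball/= sub0r normrN.
  rewrite -[t]cvec_tupleK tnth_mktuple; case: (fintype.split i) => j.
    exact: le_lt_trans (normc_Re _) (bt j).
  exact: le_lt_trans (normc_Im _) (bt j).
rewrite (@lebesgue_tuple_prod _ _ (fun=> ball (0 : RT) b) (b *+ 2)).
- by rewrite ltry.
- by move=> i; exact: measurable_ball.
- by move=> i; rewrite lebesgue_measure_ball// ltW.
Qed.

Variables (Om : set Cn) (phi : Cn -> Cn) (oOm : open Om).
Hypothesis hphi : forall j, holomorphic Om (fun z => phi z ord0 j).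

Lemma open_holomorphic_preimage (A : set Cn) : open A ->
  open (Om `&` phi @^-1` A).
Proof.
move=> oA; rewrite openE => z [Omz Az].
apply: filterI; first exact: open_nbhs_nbhs.
have /nbhs_ballP[e /= e0 eA] := open_nbhs_nbhs (conj oA Az).
have : \forall w \near z, forall j : 'I_n, `|phi z ord0 j - phi w ord0 j| < e.
  apply: (@filter_forall _ _
    (fun j w => `|phi z ord0 j - phi w ord0 j| < e) (nbhs z) _) => j.
  have : phi w ord0 j @[w --> z] --> phi z ord0 j.
    exact: differentiable_continuous (hphi j Omz).
  by move/cvgrPdist_lt => /(_ _ e0).
apply: filterS => w zw; apply: eA; split=> // i j.
by rewrite (ord1 i); exact: zw.
Qed.

Variable L : R.
Hypotheses (L0 : 0 < L) (Lphi : re_im_lipschitz Om phi L).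
Hypothesis sphi : set_surj Om Om phi.

(** Surjectivity places A inside the image of its preimage, so [lipschitz_image_volume] applies in
    real dimension n + n. *)
Lemma volume_surj_le (A : set Cn) : open A -> A `<=` Om ->
  (@volume R n A <=
   ((L *+ 2) ^+ (n + n))%:E * @volume R n (Om `&` phi @^-1` A))%E.
Proof.
move=> oA AOm; have oU := open_holomorphic_preimage oA.
have mpre B : open B -> measurable (@cvec_tuple R n @^-1` B).
  move=> oB; rewrite -[X in measurable X]setTI.
  by apply: measurable_cvec_tuple => //; exact: measurable_open.
apply: (@lipschitz_image_volume _ _
  (fun t => re_im (phi (cvec_tuple t)))) => //.
- exact: mpre.
- exact: mpre.
- by move=> t Ut; exact: cvec_tuple_box Ut.
- by move=> t s r [Omt _] [Oms _]; exact: Lphi.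
move=> t At; have [w Omw wt] := sphi (AOm _ At).
exists (re_im w); rewrite /= re_imK; last by rewrite wt cvec_tupleK.
by split=> //=; rewrite wt.
Qed.

Hypotheses (bOm : bounded_set Om) (fphi : set_fun Om Om phi).

(** The phi-preimage of a superlevel set of |f| is a superlevel set of |g| at the same height, so
    [volume_surj_le] supplies the hypothesis of [integral_le_of_superlevel]. The square root of the
    volume constant appears on passing from integrals to norms. *)
Lemma bergman_norm_comp_ge (f g : bergman oOm) :
  (forall z, Om z -> g z = f (phi z)) ->
  bergman_norm Om f <= Num.sqrt ((L *+ 2) ^+ (n + n)) * bergman_norm Om g.
Proof.
move=> gf; set K := _ ^+ _.
have K0 : 0 <= K by rewrite exprn_ge0// mulrn_wge0// ltW.
have /asboolP[hf foo _] := valP f; have /asboolP[hg goo _] := valP g.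
have mOm := measurable_open oOm.
(* Rewriting the sets in terms of the modulus itself makes [open_normc_gt] applicable. *)
have super (h : Cn -> R[i]) t : 0 <= t ->
    Om `&` [set z | t < normc (h z) ^+ 2] =
    Om `&` [set z | Num.sqrt t < normc (h z)].
  move=> t0; apply/seteqP; split=> z [Omz /= tz]; split=> //=.
    have n0 : 0 <= normc (h z) by case: (h z) => a b; exact: sqrtr_ge0.
    by rewrite -(ger0_norm n0) -sqrtr_sqr ltr_sqrt// (le_lt_trans t0).
  have s0 : 0 <= Num.sqrt t := sqrtr_ge0 t.
  by rewrite -(sqr_sqrtr t0) ltrXn2r//= (le_trans s0)// ltW.
have int_ge0 (h : Cn -> R[i]) :
    (0 <= \int[@volume R n]_(z in (Om : set BCn)) (normc (h z) ^+ 2)%:E)%E.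
  by apply: integral_ge0 => z _; rewrite lee_fin sqr_ge0.
rewrite /bergman_norm -sqrtrM// ler_wsqrtr// /Rintegral.
rewrite -[X in X * _]/(fine K%:E) -fineM//; last first.
  by rewrite ge0_fin_numE.
apply: fine_le.
- by rewrite ge0_fin_numE.
- by rewrite fin_numM// ge0_fin_numE.
apply: integral_le_of_superlevel => //.
- exact: volume_bounded_lty.
- by apply: measurable_funX; exact: measurable_normc.
- by apply: measurable_funX; exact: measurable_normc.
- by move=> z _; exact: sqr_ge0.
- by move=> z _; exact: sqr_ge0.
move=> t t0; rewrite !super//.
apply: le_trans (volume_surj_le _ _) _; last 1 first.
- apply: lee_wpmul2l; first by rewrite lee_fin.
  apply: le_measure; rewrite ?inE.
  + apply: measurable_open; apply: open_holomorphic_preimage.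
    exact: open_normc_gt.
  + by apply: measurable_open; exact: open_normc_gt.
  by move=> z [Omz [_ /=]]; split=> //=; rewrite gf.
- exact: open_normc_gt.
- by move=> z [].
Qed.

End pullback.

(** * Powers of a coordinate *)

(** Differentiability depends only on the germ. This handles the extension by 0 in [coord_power],
    which agrees with a monomial only near points of Om. *)
Lemma near_eq_differentiable (K : numFieldType) (V W : normedModType K)
    (f g : V -> W) (x : V) :
  (\forall y \near x, f y = g y) -> differentiable f x -> differentiable g x.
Proof.
move=> fg /diff_locallyP[cdf ef].
have gx : g x = f x by rewrite (nbhs_singleton fg).
have fg0 : \forall h \near (0 : V), f (h + x) = g (h + x).
  by have := fg; rewrite (near_shift 0); apply: filterS => h /=; rewrite subr0.
have eg : g \o shift x = cst (g x) + 'd f x +o_ 0 id.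
  move/eqaddoP : ef => ef; apply/eqaddoP => e e0.
  apply: filterS2 fg0 (ef e e0) => h /= E.
  by rewrite -[X in `|X| <= _ -> _]/(f (h + x) - (f x + 'd f x h))
    -[X in _ -> `|X| <= _]/(g (h + x) - (g x + 'd f x h)) E gx.
by apply/diff_locallyP; rewrite (diff_unique cdf eg).
Qed.

Section powers.
Context {R : realType} {n : nat}.
Local Notation Cn := 'rV[R[i]]_n.
Local Notation BCn := (g_sigma_algebraType (@open Cn)).
Import Normc.
Variables (Om : set Cn) (oOm : open Om) (bOm : bounded_set Om) (i0 : 'I_n).

Lemma normc_ge0 (z : R[i]) : 0 <= normc z.
Proof. by case: z => a b; exact: sqrtr_ge0. Qed.

Lemma normcE (z : R[i]) : (normc z)%:C%C = `|z|.
Proof. by []. Qed.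

Lemma normc_real (c : R) : normc c%:C%C = `|c|.
Proof. by rewrite /normc/= expr0n addr0 sqrtr_sqr. Qed.

Lemma normcX (z : R[i]) k : normc (z ^+ k) = normc z ^+ k.
Proof.
elim: k => [|k IH]; first by rewrite !expr0 normc1.
by rewrite !exprS normcM IH.
Qed.

(** Inside a ball around z contained in Om, the coordinate can be pushed outward along its own
    argument. *)
Lemma open_larger_coord (z : Cn) : Om z ->
  exists2 w, Om w & normc (z ord0 i0) < normc (w ord0 i0).
Proof.
move=> Omz; have /nbhs_ballP[e /= e0 eOm] := open_nbhs_nbhs (conj oOm Omz).
have eR : e = (complex.Re e)%:C%C by rewrite RRe_real// gtr0_real.
pose d := complex.Re e / 2.
have d0 : 0 < d by rewrite divr_gt0// -ltcR -eR.
have de : d < complex.Re e.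
  by rewrite /d ltr_pdivrMr// ltr_pMr ?ltr1n// -ltcR -eR.
(* The unimodular direction of the coordinate, with 1 chosen when the coordinate vanishes. *)
pose u : R[i] := if z ord0 i0 == 0 then 1 else z ord0 i0 / `|z ord0 i0|.
have u1 : normc u = 1.
  rewrite /u; case: ifPn => [_|z0]; first exact: normc1.
  by apply: (@complexI R); rewrite normcE normf_div normr_id divff// normr_eq0.
have zu : z ord0 i0 = (normc (z ord0 i0))%:C%C * u.
  rewrite /u normcE; case: eqVneq => [->|z0].
    by rewrite normr0 mul0r.
  by rewrite mulrCA divff ?mulr1// normr_eq0.
exists (\row_j (z ord0 j + (if j == i0 then d%:C%C * u else 0))).
  apply: eOm; split=> // i j; rewrite (ord1 i) !mxE /ball/= opprD addNKr normrN.
  case: ifP => _; last by rewrite normr0.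
  by rewrite -normcE normcM u1 mulr1 normc_real gtr0_norm// eR ltcR.
rewrite mxE eqxx {2}zu -mulrDl -rmorphD normcM u1 mulr1 normc_real.
by rewrite gtr0_norm ?ltrDl// ltr_wpDl// normc_ge0.
Qed.

Definition coord_power k (z : Cn) : R[i] :=
  if `[< Om z >] then z ord0 i0 ^+ k else 0.

Lemma coord_powerE k z : Om z -> coord_power k z = z ord0 i0 ^+ k.
Proof. by move=> Omz; rewrite /coord_power asboolT. Qed.

Lemma holomorphic_coord_power k : holomorphic Om (coord_power k).
Proof.
move=> z Omz; apply: (@near_eq_differentiable _ _ _
  (fun z : Cn => z ord0 i0 ^+ k)).
  near=> w; rewrite coord_powerE//; near: w; exact: open_nbhs_nbhs.
have dc : differentiable (fun z : Cn => z ord0 i0 : R[i]) z.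
  exact: differentiable_coord.
elim: k => [|k IH].
  exact: differentiable_cst.
rewrite (_ : (fun _ => _) = (fun z : Cn => z ord0 i0 : R[i]) *
    (fun z : Cn => z ord0 i0 ^+ k : R[i])).
  exact: differentiableM.
by apply/funext => w; rewrite exprS.
Unshelve. all: by end_near. Qed.

Lemma coord_power_bergman k : coord_power k \in bergman_pred oOm.
Proof.
apply/asboolP; split; first exact: holomorphic_coord_power.
  have [b b0 Omb] := bounded_set_normc bOm.
  have mOm := measurable_open oOm.
  apply: (@le_lt_trans _ _
      (\int[@volume R n]_(z in (Om : set BCn)) ((b ^+ k) ^+ 2)%:E)%E).
    apply: ge0_le_integral => //.
    - by move=> z _; rewrite lee_fin sqr_ge0.
    - apply/measurable_EFinP/measurable_funX; apply: (measurable_normc oOm).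
      exact: holomorphic_coord_power.
    move=> z Omz; rewrite lee_fin coord_powerE// normcX.
    by rewrite !lerXn2r ?nnegrE ?exprn_ge0 ?normc_ge0 ?(ltW b0)// ltW// Omb.
  rewrite integral_cst//= lte_mul_pinfty ?lee_fin ?sqr_ge0//.
  exact: volume_bounded_lty.
by move=> z Omz; rewrite /coord_power asboolF.
Qed.

(** A Chebyshev bound: restrict the integral to U. It bounds the norms of the powers from below and
    later forces a cluster point to vanish. *)
Lemma bergman_norm_ge (f : bergman oOm) (U : set Cn) (a : R) :
  open U -> U `<=` Om -> 0 <= a -> (forall z, U z -> a <= normc (f z)) ->
  a * Num.sqrt (fine (@volume R n U)) <= bergman_norm Om f.
Proof.
move=> oU UOm a0 Ua; have /asboolP[hf foo _] := valP f.
have mOm := measurable_open oOm; have mU := measurable_open oU.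
have Uoo : (@volume R n U < +oo)%E.
  apply: le_lt_trans (volume_bounded_lty bOm oOm).
  by apply: le_measure; rewrite ?inE.
have mf2 : measurable_fun (Om : set BCn)
    (fun z => (normc (f z) ^+ 2 : R)%:E : \bar R).
  by apply/measurable_EFinP/measurable_funX; exact: measurable_normc.
have f0 (D : set BCn) :
    (0 <= \int[@volume R n]_(z in D) (normc (f z) ^+ 2)%:E)%E.
  by apply: integral_ge0 => z _; rewrite lee_fin sqr_ge0.
rewrite /bergman_norm -[X in X * _](ger0_norm a0) -sqrtr_sqr -sqrtrM ?sqr_ge0//.
rewrite ler_wsqrtr// /Rintegral -[X in X * _]/(fine (a ^+ 2)%:E).
rewrite -fineM//; last by rewrite ge0_fin_numE.
apply: fine_le.
- by rewrite fin_numM// ge0_fin_numE.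
- by rewrite ge0_fin_numE.
rewrite -integral_cst//.
apply: (@le_trans _ _
    (\int[@volume R n]_(z in (U : set BCn)) (normc (f z) ^+ 2)%:E)%E).
  apply: ge0_le_integral => //.
  - by move=> z _; rewrite /cst lee_fin sqr_ge0.
  - exact: measurable_funS mf2.
  by move=> z Uz; rewrite lee_fin lerXn2r ?nnegrE ?normc_ge0// Ua.
by apply: ge0_subset_integral => // z _; rewrite lee_fin sqr_ge0.
Qed.

Lemma bergman_normZr (c : R) (f : bergman oOm) : 0 <= c ->
  bergman_norm Om ((c%:C%C *: f : bergman oOm) : Cn -> R[i]) =
  c * bergman_norm Om f.
Proof.
move=> c0; have := normrZ (c%:C%C) f.
rewrite -[`|_ *: _|]/((bergman_norm _ _)%:C%C).
rewrite -[`|f|]/((bergman_norm _ _)%:C%C).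
by rewrite -normcE normc_real ger0_norm// -rmorphM => /complexI.
Qed.

End powers.

(** * Locally uniform decay and failure of compactness *)

Section not_compact.
Context {R : realType} {n : nat}.
Local Notation Cn := 'rV[R[i]]_n.
Import Normc.
Variables (Om : set Cn) (oOm : open Om) (bOm : bounded_set Om).

(** Given w, choose w' in Om with a larger coordinate modulus s. The norm of the k-th power is at
    least a constant times s^k, whereas near w its values are at most a^k for some a < s. Norm 1/2
    puts the sequence inside the open unit ball. *)
Lemma normalized_coord_powers (i0 : 'I_n) : Om !=set0 ->
  exists x : nat -> bergman oOm, (forall k, bergman_norm Om (x k) = 2^-1) /\
    forall w, Om w -> forall e : R, 0 < e -> exists U N, [/\ open U, U w &
      forall k z, (N <= k)%N -> U z -> normc (x k z) < e].
Proof.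
move=> [p Omp]; have [g gE] : exists g : nat -> bergman oOm,
    forall k z, Om z -> g k z = z ord0 i0 ^+ k.
  exists (fun k => Bergman (coord_power_bergman oOm bOm i0 k)) => k z.
  exact: coord_powerE.
have oU (a : R) : open (Om `&` [set z | a < normc (z ord0 i0)]).
  by apply: open_normc_gt => // z _; exact: differentiable_coord.
have g_ge w : Om w -> exists2 v : R, 0 < v &
    forall k, normc (w ord0 i0) ^+ k * v <= bergman_norm Om (g k).
  move=> Omw; pose U := Om `&` [set z | normc (w ord0 i0) < normc (z ord0 i0)].
  exists (Num.sqrt (fine (@volume R n U))).
    rewrite sqrtr_gt0 fine_gt0//; apply/andP; split.
      apply: volume_gt0; first exact: oU.
      by have [w' Omw' ww'] := open_larger_coord oOm i0 Omw; exists w'.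
    apply: le_lt_trans (volume_bounded_lty bOm oOm).
    by apply: le_measure; rewrite ?inE;
      [exact: measurable_open (oU _)|exact: measurable_open|move=> ? []].
  move=> k; apply: bergman_norm_ge => //.
  - exact: oU.
  - by move=> ? [].
  - by rewrite exprn_ge0// normc_ge0.
  move=> z [Omz /= wz]; rewrite gE// normcX.
  by rewrite lerXn2r ?nnegrE ?normc_ge0// ltW.
have g0 k : 0 < bergman_norm Om (g k).
  have [q Omq pq] := open_larger_coord oOm i0 Omp; have [v v0 vg] := g_ge _ Omq.
  apply: lt_le_trans (vg k); rewrite mulr_gt0// exprn_gt0//.
  by apply: le_lt_trans pq; exact: normc_ge0.
pose c k := (2 * bergman_norm Om (g k))^-1.
have c0 k : 0 < c k by rewrite invr_gt0 mulr_gt0.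
exists (fun k => (c k)%:C%C *: g k); split.
  move=> k; rewrite bergman_normZr ?ltW// /c invfM mulrVK//.
  by rewrite unitfE gt_eqF.
move=> w Omw e e0.
have [w' Omw' ww'] := open_larger_coord oOm i0 Omw.
have [v v0 vg] := g_ge _ Omw'.
set r := normc (w ord0 i0) in ww'; set s := normc (w' ord0 i0) in ww' vg.
have r0 : 0 <= r by exact: normc_ge0.
have s0 : 0 < s := le_lt_trans r0 ww'.
have [a ra as1] : exists2 a, r < a & a < s by exists ((r + s) / 2); lra.
have a0 : 0 < a := le_lt_trans r0 ra.
have : (a / s) ^+ k @[k --> \oo] --> 0.
  by apply: cvg_expr; rewrite ger0_norm ?divr_ge0 ?ltW// ltr_pdivrMr// mul1r.
(* The threshold is chosen so that (a/s)^k < 2 v e gives a^k / (2 s^k v) < e, which bounds the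
   normalized power. *)
move=> /cvgrPdist_lt /(_ (e * (2 * v))).
rewrite !mulr_gt0// => /(_ isT)[N _ aN].
exists (Om `&` (fun z : Cn => z ord0 i0) @^-1` ball (0 : R[i]) a%:C%C), N.
split.
- apply: openI => //; apply: open_comp; last exact: ball_open.
  by move=> z _; exact: coord_continuous.
- by split=> //=; rewrite /ball/= sub0r normrN -normcE ltcR.
move=> k z Nk [Omz]; rewrite /= /ball/= sub0r normrN -normcE ltcR => za.
have xE : normc (((c k)%:C%C *: g k : bergman oOm) z) =
    c k * normc (z ord0 i0) ^+ k.
  transitivity (normc ((c k)%:C%C * g k z)) => //.
  by rewrite normcM normc_real gtr0_norm// gE// normcX.
suff : c k * normc (z ord0 i0) ^+ k < e by rewrite -xE.
rewrite /c ltr_pdivrMl ?mulr_gt0//.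
apply: (@lt_le_trans _ _ (2 * (s ^+ k * v) * e)); last first.
  by rewrite ler_pM2r// ler_pM2l.
apply: (@le_lt_trans _ _ (a ^+ k)).
  by rewrite lerXn2r ?nnegrE ?normc_ge0 ?(ltW a0)// ltW.
have := aN k Nk; rewrite /= sub0r normrN ger0_norm; last first.
  by rewrite exprn_ge0// divr_ge0// ltW.
rewrite expr_div_n ltr_pdivrMr ?exprn_gt0//.
rewrite (_ : e * _ * _ = 2 * (s ^+ k * v) * e)//; ring.
Qed.

Lemma not_compact_of_bounded_below (i0 : 'I_n) (phi : Cn -> Cn)
    (T : {linear bergman oOm -> bergman oOm}) (M : R) :
  Om !=set0 -> (forall j, holomorphic Om (fun z => phi z ord0 j)) ->
  set_fun Om Om phi -> 0 < M ->
  (forall (f : bergman oOm) z, Om z -> T f z = f (phi z)) ->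
  (forall f : bergman oOm, bergman_norm Om f <= M * bergman_norm Om (T f)) ->
  ~ compact_operator T.
Proof.
move=> Om0 hphi fphi M0 Tphi Tge; rewrite /compact_operator precompactE => cT.
have [x [x2 xlim]] := normalized_coord_powers i0 Om0.
have [|h [_ hT]] := cT ((T \o x) @ \oo) (fmap_proper_filter _ _).
  exists 0%N => // k _; apply: subset_closure; exists (x k) => //=.
  have : (2^-1 : R)%:C%C < (1 : R)%:C%C by rewrite ltcR invf_lt1// ltr1n.
  by rewrite bergman_normE x2.
(* The cluster property in usable form: [T (x k)] comes within d of h for arbitrarily large k. *)
have {}hT (d : R) N : 0 < d ->
    exists2 k, (N <= k)%N & bergman_norm Om (h - T (x k)) < d.
  move=> d0; have dC : 0 < d%:C%C by rewrite ltcR.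
  have [] := hT [set f | exists2 k, (N <= k)%N & f = T (x k)] (ball h d%:C%C).
  - by exists N => // k /= Nk; exists k.
  - exact: nbhsx_ballx.
  move=> _ [[k Nk ->]]; rewrite -ball_normE /= => hk; exists k => //.
  by move: hk; rewrite bergman_normE ltcR.
have h0 : h = 0.
  have /asboolP[hh _ hOm] := valP h.
  apply/val_inj/funext => z; apply: contrapT => /eqP hz.
  have Omz : Om z by apply: contrapT => /hOm; exact/eqP.
  pose a := normc (h z) / 2.
  have a0 : 0 < a.
    rewrite divr_gt0// lt_neqAle normc_ge0 andbT eq_sym; apply: contra hz.
    by move=> /eqP/eq0_normc hz; exact/eqP.
  have a20 : 0 < a / 2 by rewrite divr_gt0.
  have [V [N [oV Vw Vx]]] := xlim _ (fphi _ Omz) _ a20.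
  (* On U, |h| exceeds a while |x_k o phi| is below a/2 for k >= N. Hence h - T x_k has modulus at
     least a/2 there, and its norm stays away from 0, against [hT]. *)
  pose U := (Om `&` [set z | a < normc (h z)]) `&` (Om `&` phi @^-1` V).
  have oU : open U.
    by apply: openI; [exact: open_normc_gt|exact: open_holomorphic_preimage].
  have Uz : U z.
    by split; split=> //=; move: a0; rewrite /a; lra.
  have U0 : 0 < fine (@volume R n U).
    rewrite fine_gt0//; apply/andP; split.
      by apply: volume_gt0 => //; exists z.
    apply: le_lt_trans (volume_bounded_lty bOm oOm).
    by apply: le_measure; rewrite ?inE;
      [exact: measurable_open oU|exact: measurable_open|move=> ? [[]]].
  have [] := hT (a / 2 * Num.sqrt (fine (@volume R n U))) N.
    by rewrite mulr_gt0// sqrtr_gt0.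
  move=> k Nk; apply/negP; rewrite -leNgt; apply: bergman_norm_ge => //.
  - by move=> ? [[]].
  - exact: ltW.
  move=> y [[Omy /= ay] [_ Vy]].
  suff : a / 2 <= normc (h y - T (x k) y) by [].
  rewrite Tphi//.
  have := Vx _ _ Nk Vy.
  have := le_normcD (h y - x k (phi y) : Rcomplex R) (x k (phi y) : Rcomplex R).
  by rewrite subrK; lra.
(* With h = 0 some [T (x k)] has norm below 1/(2M), whereas 1/2 = ||x_k|| <= M ||T x_k||. *)
have [|k _] := hT ((2 * M)^-1) 0%N; first by rewrite invr_gt0 mulr_gt0.
apply/negP; rewrite -leNgt h0 sub0r.
have -> : bergman_norm Om (- T (x k) : bergman oOm) = bergman_norm Om (T (x k)).
  by apply: (@complexI R); rewrite -!bergman_normE normrN.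
by rewrite invfM ler_pdivrMr// mulrC -(x2 k).
Qed.

End not_compact.

Theorem corollary1 (R : realType) (n : nat) (Om : set 'rV[R[i]]_n)
    (phi : 'rV[R[i]]_n -> 'rV[R[i]]_n) (oOm : open Om) :
  (2 <= n)%N ->
  Om !=set0 -> connected Om ->
  bounded_set Om -> convex_set Om -> smooth_boundary (@cvec R n @^-1` Om) ->
  set_fun Om Om phi ->
  (forall j, holomorphic Om (fun z => phi z ord0 j)) ->
  (forall j, C1_on_cclosure Om (fun z => phi z ord0 j)) ->
  set_surj Om Om phi -> proper_on Om phi ->
  ~ exists2 T : {linear bergman oOm -> bergman oOm},
      forall f z, Om z -> T f z = f (phi z) & compact_operator T.
Proof.
move=> n2 Om0 _ bOm cOm _ fphi hphi C1 sphi _ [T Tphi cT].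
have [L L0 Lphi] := C1_on_cclosure_lipschitz bOm cOm C1.
have i0 : 'I_n := Ordinal (ltnW n2).
apply: (@not_compact_of_bounded_below _ _ _ oOm bOm i0 phi T
  (Num.sqrt ((L *+ 2) ^+ (n + n)))) cT => //.
  by rewrite sqrtr_gt0 exprn_gt0// mulrn_wgt0.
move=> f; apply: bergman_norm_comp_ge Lphi _ _ _ _ _ => //.
exact: Tphi.
Qed.
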